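(* Let $n\ge2$, let $X$ be a non-empty set, and let $B$ be the free object on $X$ in the category $\mathcal{RN}_n$ of skew braces that are right nilpotent of class at most $n$. Then $B$ is residually finite. If, moreover, $X$ is finite, then $B$ is Hopfian.
   Context: A (left) skew brace is a triple $(B,+,\circ)$ with $(B,+)$ and $(B,\circ)$ groups such that $a\circ(b+c)=a\circ b-a+a\circ c$ for all $a,b,c$. Put $\lambda_a(b)=-a+a\circ b$, $a*b=\lambda_a(b)-b$. Put $B^{(1)}=B$ and let $B^{(k+1)}$ be the subgroup of $(B,+)$ generated by all $a*b$ with $a\in B^{(k)}$, $b\in B$. $B$ is right nilpotent of class at most $n$ if $B^{(n+1)}=\{0\}$. Homomorphisms preserve both operations. An ideal of $B$ is a subset $I$ that is a normal subgroup of $(B,+)$ and of $(B,\circ)$ with $\lambda_b(I)=I$ for all $b\in B$; then $B/I$ is a skew brace. $B$ is residually finite if the intersection of all ideals $I$ with $B/I$ finite is $\{0\}$. $B$ is Hopfian if it is not isomorphic to any of its proper quotients (equivalently, every surjective endomorphism is injective). The free object on $X$ in $\mathcal{RN}_n$ is a member $B$ with a map $i\colon X\to B$ such that each map from $X$ to a member $K$ factors as $\varphi\circ i$ for a unique skew brace homomorphism $\varphi\colon B\to K$; it exists. *)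

(* Defs.v *)
From HB Require Import structures.
From mathcomp Require Import all_boot all_classical.

Set Implicit Arguments.
Unset Strict Implicit.
Unset Printing Implicit Defensive.

Declare Scope skew_brace_scope.
Delimit Scope skew_brace_scope with sb.

Local Open Scope classical_set_scope.
Local Open Scope skew_brace_scope.
Local Open Scope group_scope.

(* The circle operation is the library's group law [*] with unit [1]; the
   additive group, which need not be commutative, cannot come from the library's
   additive structures. *)
HB.mixin Record Group_isSkewBrace B of Group B := {
  sbadd : B -> B -> B;
  sbzero : B;
  sbopp : B -> B;
  sbaddA : forall a b c : B, sbadd a (sbadd b c) = sbadd (sbadd a b) c;
  sbadd0r : forall a : B, sbadd sbzero a = a;
  sbaddr0 : forall a : B, sbadd a sbzero = a;
  sbaddNr : forall a : B, sbadd (sbopp a) a = sbzero;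
  sbaddrN : forall a : B, sbadd a (sbopp a) = sbzero;
  sb_mulDr : forall a b c : B,
    a * sbadd b c = sbadd (sbadd (a * b) (sbopp a)) (a * c)
}.

#[short(type="skewBraceType")]
HB.structure Definition SkewBrace := {B of Group_isSkewBrace B & Group B}.

Notation "x + y" := (sbadd x y) : skew_brace_scope.
Notation "- x" := (sbopp x) : skew_brace_scope.
Notation "x - y" := (sbadd x (sbopp y)) : skew_brace_scope.
Notation "0" := (@sbzero _) : skew_brace_scope.

(* Alias of B carrying (B, +) as a library group. *)
Definition addgrp (B : skewBraceType) : Type := B.

HB.instance Definition _ (B : skewBraceType) := Choice.on (addgrp B).
HB.instance Definition _ (B : skewBraceType) :=
  isGroup.Build (addgrp B)
    (@sbaddA B) (@sbadd0r B) (@sbaddr0 B) (@sbaddNr B) (@sbaddrN B).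

Definition is_subgroup (G : groupType) (H : set G) : Prop :=
  H 1 /\ forall x y : G, H x -> H y -> H (x / y).

Definition is_normal_subgroup (G : groupType) (H : set G) : Prop :=
  is_subgroup H /\ forall x y : G, H x -> H (x ^ y).

Definition sblambda (B : skewBraceType) (a b : B) : B := - a + a * b.

Definition sbstar (B : skewBraceType) (a b : B) : B := sblambda a b - b.

(* [right_series B k] is B^(k) for 0 < k; the value at k = 0 is irrelevant. *)
Definition right_series (B : skewBraceType) (k : nat) : set B :=
  iter k.-1
    (fun S : set B =>
       smallest (@is_subgroup (addgrp B)) [set sbstar a b | a in S & b in setT])
    setT.

Arguments right_series : clear implicits.

Definition right_nilpotent (n : nat) (B : skewBraceType) : Prop :=
  right_series B n.+1 = [set 0].

Definition skew_brace_hom (B K : skewBraceType) (f : B -> K) : Prop :=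
  {morph f : x y / x + y} /\ {morph f : x y / x * y}.

Definition skew_brace_isomorphic (B K : skewBraceType) : Prop :=
  exists f : B -> K, skew_brace_hom f /\ bijective f.

(* Free object on X in the category of right nilpotent skew braces of class at
   most n. *)
Definition is_free_RN (n : nat) (X : Type) (B : skewBraceType) (i : X -> B)
    : Prop :=
  right_nilpotent n B /\
  forall K : skewBraceType, right_nilpotent n K ->
  forall f : X -> K,
    exists! phi : B -> K, skew_brace_hom phi /\ f = phi \o i.

Definition is_ideal (B : skewBraceType) (I : set B) : Prop :=
  [/\ @is_normal_subgroup (addgrp B) I,
      @is_normal_subgroup B I
    & forall b : B, sblambda b @` I = I].

Record ideal (B : skewBraceType) := Ideal {
  ideal_set :> set B;
  idealP : is_ideal ideal_set
}.

Definition coset (B : skewBraceType) (I : set B) (a : B) : set B :=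
  [set a + x | x in I].

Definition cosets (B : skewBraceType) (I : set B) : set (set B) :=
  range (coset I).

Definition quot (B : skewBraceType) (I : ideal B) : Type := cosets I.

HB.instance Definition _ (B : skewBraceType) (I : ideal B) :=
  Choice.on (quot I).

Section QuotientSkewBrace.

Variables (B : skewBraceType) (J : ideal B).

Local Notation I := (ideal_set J).
Local Notation cI := (coset I).

Lemma sb_add_cancel (a b : B) : a + (- a + b) = b.
Proof. by rewrite sbaddA sbaddrN sbadd0r. Qed.

Lemma sb_opp_cancel (a b : B) : - a + (a + b) = b.
Proof. by rewrite sbaddA sbaddNr sbadd0r. Qed.

Lemma sb_oppD (a b : B) : - (a + b) = - b - a.
Proof. exact: (@invgM (addgrp B) a b). Qed.

Lemma sb_oppK (a : B) : - - a = a.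
Proof. exact: (@invgK (addgrp B) a). Qed.

Lemma sb_mulr0 (a : B) : a * 0 = a.
Proof.
have H := sb_mulDr a 0 0; rewrite sbaddr0 in H.
have E : a * 0 - a = 0.
  apply: (@mulIg (addgrp B) (a * 0)); rewrite /= -[LHS]H; exact/esym/sbadd0r.
apply: (@mulIg (addgrp B) (- a)); exact: etrans E (esym (sbaddrN a)).
Qed.

Lemma sb_one : 1 = 0 :> B.
Proof. by rewrite -[RHS]mul1g sb_mulr0. Qed.

Lemma sb_mulE (a b : B) : a * b = a + sblambda a b.
Proof. by rewrite /sblambda sb_add_cancel. Qed.

Lemma ideal_0 : I 0. Proof. by case: (idealP J) => -[[]]. Qed.

Lemma ideal_sub (x y : B) : I x -> I y -> I (x - y).
Proof. by case: (idealP J) => -[[_ H] _] _ _; apply: H. Qed.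

Lemma ideal_opp (x : B) : I x -> I (- x).
Proof. by move=> Ix; rewrite -[- x]sbadd0r; apply: ideal_sub ideal_0 Ix. Qed.

Lemma ideal_add (x y : B) : I x -> I y -> I (x + y).
Proof. by move=> Ix Iy; rewrite -[y]sb_oppK; apply/ideal_sub/ideal_opp. Qed.

Lemma ideal_conj (x y : B) : I x -> I (- y + (x + y)).
Proof. by case: (idealP J) => -[_ H] _ _ Ix; apply: (H x y). Qed.

Lemma ideal_div (x y : B) : I x -> I y -> I (x / y).
Proof. by case: (idealP J) => _ [[_ H] _] _; apply: H. Qed.

Lemma ideal_inv (x : B) : I x -> I x^-1.
Proof.
by move=> Ix; rewrite -[x^-1]mul1g; apply: ideal_div Ix; rewrite sb_one; exact: ideal_0.
Qed.

Lemma ideal_mul (x y : B) : I x -> I y -> I (x * y).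
Proof. by move=> Ix Iy; rewrite -[y]invgK; apply/ideal_div/ideal_inv. Qed.

Lemma ideal_conjg (x y : B) : I x -> I (x ^ y).
Proof. by case: (idealP J) => _ [_ H] _; apply: H. Qed.

Lemma coset_mulE (a : B) : cI a = [set a * x | x in I].
Proof.
have lI : sblambda a @` I = I by case: (idealP J).
apply/seteqP; split=> z [x Ix <-].
  by move: Ix; rewrite -{1}lI => -[y Iy <-]; exists y => //; rewrite sb_mulE.
by exists (sblambda a x); rewrite ?sb_mulE // -lI; exists x.
Qed.

Lemma cosetD (a b : B) : [set c + d | c in cI a & d in cI b] = cI (a + b).
Proof.
apply/seteqP; split=> z.
  move=> [_ [x Ix <-]] [_ [y Iy <-]] <-.
  exists (- b + (x + b) + y); first by apply/ideal_add/Iy/ideal_conj.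
  by rewrite -!sbaddA sb_add_cancel.
move=> [x Ix <-]; exists a; first by exists 0; [exact: ideal_0 | exact: sbaddr0].
by exists (b + x); [exists x | rewrite sbaddA].
Qed.

Lemma cosetN (a : B) : [set - c | c in cI a] = cI (- a).
Proof.
apply/seteqP; split=> z.
  move=> [_ [x Ix <-]] <-; exists (- - a + (- x - a)).
    by apply/ideal_conj/ideal_opp.
  by rewrite sb_oppK sb_opp_cancel sb_oppD.
move=> [x Ix <-]; exists (- (- a + x)); last exact: sb_oppK.
exists (- a + (- x + a)); first by apply/ideal_conj/ideal_opp.
by rewrite sb_add_cancel sb_oppD sb_oppK.
Qed.

Lemma cosetM (a b : B) : [set c * d | c in cI a & d in cI b] = cI (a * b).
Proof.
rewrite !coset_mulE; apply/seteqP; split=> z.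
  move=> [_ [x Ix <-]] [_ [y Iy <-]] <-.
  exists (x ^ b * y); first by apply/ideal_mul/Iy/ideal_conjg.
  by rewrite conjgE !mulgA mulgK.
move=> [x Ix <-]; exists a; first by exists 0; [exact: ideal_0 | exact: sb_mulr0].
by exists (b * x); [exists x | rewrite mulgA].
Qed.

Lemma cosetV (a : B) : [set c^-1 | c in cI a] = cI a^-1.
Proof.
rewrite !coset_mulE; apply/seteqP; split=> z.
  move=> [_ [x Ix <-]] <-; exists (x^-1 ^ a^-1).
    by apply/ideal_conjg/ideal_inv.
  by rewrite conjgE invgK !mulgA mulVg mul1g invgM.
move=> [x Ix <-]; exists (a^-1 * x)^-1; last exact: invgK.
exists (x^-1 ^ a); first by apply/ideal_conjg/ideal_inv.
by rewrite conjgE invgM invgK !mulgA mulgV mul1g.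
Qed.

Lemma coset_in (a : B) : cI a \in cosets I.
Proof. by apply/mem_set; exists a. Qed.

Lemma quot_ex (C : quot J) : exists a, val C = cI a.
Proof. by case: C => C /= /set_mem[a _ <-]; exists a. Qed.

Fact quotD_subproof (C D : quot J) :
  [set c + d | c in val C & d in val D] \in cosets I.
Proof.
by have [a ->] := quot_ex C; have [b ->] := quot_ex D; rewrite cosetD coset_in.
Qed.

Fact quotN_subproof (C : quot J) : [set - c | c in val C] \in cosets I.
Proof. by have [a ->] := quot_ex C; rewrite cosetN coset_in. Qed.

Fact quotM_subproof (C D : quot J) :
  [set c * d | c in val C & d in val D] \in cosets I.
Proof.
by have [a ->] := quot_ex C; have [b ->] := quot_ex D; rewrite cosetM coset_in.
Qed.

Fact quotV_subproof (C : quot J) : [set c^-1 | c in val C] \in cosets I.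
Proof. by have [a ->] := quot_ex C; rewrite cosetV coset_in. Qed.

Definition quot_mk (C : set B) (CI : C \in cosets I) : quot J :=
  exist (fun C => C \in cosets I) C CI.

Definition quot_pi (a : B) : quot J := quot_mk (coset_in a).

Definition quot_add (C D : quot J) : quot J := quot_mk (quotD_subproof C D).
Definition quot_opp (C : quot J) : quot J := quot_mk (quotN_subproof C).
Definition quot_mul (C D : quot J) : quot J := quot_mk (quotM_subproof C D).
Definition quot_inv (C : quot J) : quot J := quot_mk (quotV_subproof C).

Lemma quot_piP (C : quot J) : exists a, C = quot_pi a.
Proof. by have [a E] := quot_ex C; exists a; apply: val_inj. Qed.

Lemma quot_piD (a b : B) : quot_add (quot_pi a) (quot_pi b) = quot_pi (a + b).
Proof. by apply: val_inj; exact: cosetD. Qed.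

Lemma quot_piN (a : B) : quot_opp (quot_pi a) = quot_pi (- a).
Proof. by apply: val_inj; exact: cosetN. Qed.

Lemma quot_piM (a b : B) : quot_mul (quot_pi a) (quot_pi b) = quot_pi (a * b).
Proof. by apply: val_inj; exact: cosetM. Qed.

Lemma quot_piV (a : B) : quot_inv (quot_pi a) = quot_pi a^-1.
Proof. by apply: val_inj; exact: cosetV. Qed.

Let piE := (quot_piD, quot_piN, quot_piM, quot_piV).

Fact quot_mulA : associative quot_mul.
Proof.
move=> C D E; have [a ->] := quot_piP C; have [b ->] := quot_piP D.
by have [c ->] := quot_piP E; rewrite !piE mulgA.
Qed.

Fact quot_mul1g : left_id (quot_pi 1) quot_mul.
Proof. by move=> C; have [a ->] := quot_piP C; rewrite !piE mul1g. Qed.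

Fact quot_mulg1 : right_id (quot_pi 1) quot_mul.
Proof. by move=> C; have [a ->] := quot_piP C; rewrite !piE mulg1. Qed.

Fact quot_mulVg : left_inverse (quot_pi 1) quot_inv quot_mul.
Proof. by move=> C; have [a ->] := quot_piP C; rewrite !piE mulVg. Qed.

Fact quot_mulgV : right_inverse (quot_pi 1) quot_inv quot_mul.
Proof. by move=> C; have [a ->] := quot_piP C; rewrite !piE mulgV. Qed.

HB.instance Definition _ :=
  isGroup.Build (quot J) quot_mulA quot_mul1g quot_mulg1 quot_mulVg quot_mulgV.

Fact quot_addA (C D E : quot J) :
  quot_add C (quot_add D E) = quot_add (quot_add C D) E.
Proof.
have [a ->] := quot_piP C; have [b ->] := quot_piP D.
by have [c ->] := quot_piP E; rewrite !piE sbaddA.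
Qed.

Fact quot_add0r (C : quot J) : quot_add (quot_pi 0) C = C.
Proof. by have [a ->] := quot_piP C; rewrite !piE sbadd0r. Qed.

Fact quot_addr0 (C : quot J) : quot_add C (quot_pi 0) = C.
Proof. by have [a ->] := quot_piP C; rewrite !piE sbaddr0. Qed.

Fact quot_addNr (C : quot J) : quot_add (quot_opp C) C = quot_pi 0.
Proof. by have [a ->] := quot_piP C; rewrite !piE sbaddNr. Qed.

Fact quot_addrN (C : quot J) : quot_add C (quot_opp C) = quot_pi 0.
Proof. by have [a ->] := quot_piP C; rewrite !piE sbaddrN. Qed.

Fact quot_mulDr (C D E : quot J) :
  C * quot_add D E = quot_add (quot_add (C * D) (quot_opp C)) (C * E).
Proof.
have [a ->] := quot_piP C; have [b ->] := quot_piP D.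
by have [c ->] := quot_piP E; rewrite /mul /= !piE sb_mulDr.
Qed.

HB.instance Definition _ := Group_isSkewBrace.Build (quot J)
  quot_addA quot_add0r quot_addr0 quot_addNr quot_addrN quot_mulDr.

End QuotientSkewBrace.

Definition residually_finite (B : skewBraceType) : Prop :=
  \bigcap_(I in [set I : ideal B | finite_set [set: quot I]]) I = [set 0].

(* A proper quotient is a quotient by a non-zero ideal. *)
Definition hopfian (B : skewBraceType) : Prop :=
  forall I : ideal B, ideal_set I <> [set 0] ->
    ~ skew_brace_isomorphic B (quot I).

(* Main.v *)
(* Write [b ~_k c] when every homomorphism from [B] to a finite skew brace of
   class at most [k] identifies [b] and [c].  By induction on [k <= n], [b ~_k 0]
   forces [b] into B^(k+1); for [k = n] this is residual finiteness.

   By freeness (B,+) is generated by the elements lambda_a(x), x in X, so [b] is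
   the value of a word in letters (a,x)^(+-1).  If two adjacent letters (a,x) and
   (a',x) have opposite signs and [a ~_k a'], then -a + a' lies in B^(k+1), so
   lambda_a(x) and lambda_a'(x) agree modulo B^(k+2) and the two letters cancel
   there.  If no such pair exists, a finite quotient A of class at most k, with
   projection f, separates all the adjacent pairs which could cancel, and as for
   free groups there are permutations g(f(a),x) of {0, ..., m}, m the length of
   the word, along which the word moves 0 to m.  The additive group G^A x A with
   A acting on G^A by translation is a finite skew brace of class at most k+1; the
   homomorphism sending x to (g(-,x), f(x)) followed by evaluation at the unit
   maps lambda_a(x) to g(f(a),x).  Hence the word is trivial as soon as
   [b ~_(k+1) 0].

   Hopficity is Malcev's argument: for a surjective endomorphism theta and a
   finite K, two of the homomorphisms f o theta^j coincide, so ker theta lies in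
   ker f. *)
Require Import Defs.
From HB Require Import structures.
From mathcomp Require Import all_boot all_fingroup all_classical zify.

Set Implicit Arguments.
Unset Strict Implicit.
Unset Printing Implicit Defensive.

Local Open Scope classical_set_scope.
Local Open Scope skew_brace_scope.
Local Open Scope group_scope.

(** * Right series *)

Section Lambda.
Variable B : skewBraceType.
Implicit Types a b c x y : B.

Lemma sb_opp0 : - 0 = 0 :> B.
Proof. exact: (@invg1 (addgrp B)). Qed.

Lemma sb_addI a : injective (sbadd a).
Proof. by move=> x y E; rewrite -(sb_opp_cancel a x) E sb_opp_cancel. Qed.

Lemma sblambdaD a b c : sblambda a (b + c) = sblambda a b + sblambda a c.
Proof. by rewrite /sblambda sb_mulDr !sbaddA. Qed.

Lemma sblambda0 a : sblambda a 0 = 0.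
Proof. by rewrite /sblambda sb_mulr0 sbaddNr. Qed.

Lemma sblambdaN a b : sblambda a (- b) = - sblambda a b.
Proof.
apply: (@sb_addI (sblambda a b)).
by rewrite -sblambdaD !sbaddrN sblambda0.
Qed.

Lemma sblambda1 b : sblambda 1 b = b.
Proof. by rewrite /sblambda mul1g sb_one sb_opp0 sbadd0r. Qed.

Lemma sblambdaM a b c : sblambda (a * b) c = sblambda a (sblambda b c).
Proof.
apply: (@sb_addI (a * b)); rewrite -sb_mulE -mulgA (sb_mulE b c) sb_mulDr.
by rewrite -sbaddA.
Qed.

Lemma sb_addE a b : a + b = a * sblambda a^-1 b.
Proof. by rewrite sb_mulE -sblambdaM mulgV sblambda1. Qed.

(** Expand 0 = a^-1 ∘ a as a^-1 + lambda_{a^-1}(a). Hence an additive subgroup stable under every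
    lambda is closed under circle inverses. *)
Lemma sb_invE a : a^-1 = - sblambda a^-1 a.
Proof.
apply: (@sb_addI (sblambda a^-1 a)); rewrite sbaddrN.
apply: (@sb_addI a^-1); rewrite sbaddA -sb_mulE mulVg sb_one sbadd0r.
by rewrite sbaddr0.
Qed.

Lemma sbstarK a b : sbstar a b + b = sblambda a b.
Proof. by rewrite /sbstar -sbaddA sbaddNr sbaddr0. Qed.

End Lambda.

Section Hom.
Variables (B K : skewBraceType) (f : B -> K).
Hypothesis hf : skew_brace_hom f.

Lemma sb_homD : {morph f : x y / x + y}. Proof. by case: hf. Qed.

Lemma sb_homM : {morph f : x y / x * y}. Proof. by case: hf. Qed.

Lemma sb_hom0 : f 0 = 0.
Proof. by apply: (@sb_addI _ (f 0)); rewrite -sb_homD !sbaddr0. Qed.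

Lemma sb_homN : {morph f : x / - x}.
Proof.
by move=> x; apply: (@sb_addI _ (f x)); rewrite -sb_homD !sbaddrN sb_hom0.
Qed.

Lemma sb_hom_lambda : {morph f : x y / sblambda x y}.
Proof. by move=> x y; rewrite /sblambda sb_homD sb_homN sb_homM. Qed.

Lemma sb_hom_star : {morph f : x y / sbstar x y}.
Proof. by move=> x y; rewrite /sbstar sb_homD sb_homN sb_hom_lambda. Qed.

End Hom.

Lemma skew_brace_hom_comp (B C D : skewBraceType) (f : C -> D) (g : B -> C) :
  skew_brace_hom f -> skew_brace_hom g -> skew_brace_hom (f \o g).
Proof. by move=> [fD fM] [gD gM]; split=> x y /=; rewrite ?gD ?gM. Qed.

Section RightSeries.
Variable B : skewBraceType.
(** The shift makes [D k] equal to B^(k+1), the term whose vanishing means class at most k; [D 0] is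
    all of B. *)
Local Notation D k := (right_series B k.+1).

Lemma right_series_sub k x y : D k x -> D k y -> D k (x - y).
Proof.
case: k => [//|k] Dx Dy S SP; case: (SP) => -[_ SB] _.
by apply: SB; [apply: Dx | apply: Dy].
Qed.

Lemma right_series0 k : D k 0.
Proof. by case: k => [//|k] S [[S0 _] _]. Qed.

Lemma right_seriesN k x : D k x -> D k (- x).
Proof. by rewrite -[- x]sbadd0r; apply/right_series_sub/right_series0. Qed.

Lemma right_seriesD k x y : D k x -> D k y -> D k (x + y).
Proof.
by move=> Dx /right_seriesN Dy; rewrite -(sb_oppK y); apply: right_series_sub.
Qed.

Lemma right_series_star k a b : D k a -> D k.+1 (sbstar a b).
Proof. by move=> Da; apply: sub_gen_smallest; exists a => //; exists b. Qed.

Lemma right_seriesS_ind k (P : B -> Prop) :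
    P 0 -> (forall x y, P x -> P y -> P (x - y)) ->
    (forall a b, D k a -> P (sbstar a b)) ->
  forall x, D k.+1 x -> P x.
Proof.
move=> P0 PB Pstar x; apply: (@smallest_sub _ _ _ [set x | P x]) => //.
by move=> _ [a Da [b _ <-]]; apply: Pstar.
Qed.

Lemma right_series_decr k : D k.+1 `<=` D k.
Proof.
elim: k => [//|k IH]; apply: right_seriesS_ind.
- exact: right_series0.
- exact: right_series_sub.
by move=> a b /IH; apply: right_series_star.
Qed.

Lemma right_series_le k m : (k <= m)%N -> D m `<=` D k.
Proof.
elim: m => [|m IH]; first by rewrite leqn0 => /eqP ->.
rewrite leq_eqVlt => /predU1P[->//|/IH] sub.
by apply: subset_trans sub; apply: right_series_decr.
Qed.

Lemma right_series_conj k x y : D k x -> D k (y + x - y).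
Proof.
case: k => [//|k]; move: x; apply: right_seriesS_ind.
- by rewrite sbaddr0 sbaddrN; apply: right_series0.
- move=> u v /right_series_sub H /H; congr right_series.
  by rewrite !sb_oppD sb_oppK !sbaddA -[_ - y + y]sbaddA sbaddNr sbaddr0.
move=> a b Da.
(* [sbstar a (y + b) = sbstar a y + (y + sbstar a b - y)] *)
suff -> : y + sbstar a b - y = - sbstar a y + sbstar a (y + b).
  apply: right_seriesD; last exact: right_series_star.
  by apply: right_seriesN; apply: right_series_star.
apply: (@sb_addI _ (sbstar a y)); rewrite sb_add_cancel /sbstar sblambdaD sb_oppD.
by rewrite !sbaddA -[_ - y + y]sbaddA sbaddNr sbaddr0.
Qed.

(** The two claims feed each other: lambda_c sends [sbstar a b] to
    [sbstar (c * a * c^-1) (sblambda c b)], so conjugation-stability of [D k] gives lambda-stability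
    of [D k.+1], which in turn gives conjugation-stability of [D k.+1]. *)
Lemma right_series_lambda_conjg k :
  (forall c x, D k x -> D k (sblambda c x)) /\
  (forall c x, D k x -> D k (c * x * c^-1)).
Proof.
elim: k => [//|k [IHl IHc]].
have lD c x : D k.+1 x -> D k.+1 (sblambda c x).
  move: x; apply: right_seriesS_ind.
  - by rewrite sblambda0; apply: right_series0.
  - by move=> u v; rewrite sblambdaD sblambdaN; apply: right_series_sub.
  move=> a b Da; suff -> : sblambda c (sbstar a b) =
      sbstar (c * a * c^-1) (sblambda c b) by apply: right_series_star; exact: IHc.
  by rewrite /sbstar sblambdaD sblambdaN -!sblambdaM mulgVK.
split=> // c x Dx.
have -> : c * x * c^-1 = c + sblambda c (x + sbstar x c^-1) - c.
  rewrite -mulgA (sb_mulE x) -sbstarK sbaddA sb_mulDr mulgV sb_one sbaddr0.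
  by rewrite sb_mulE.
apply/right_series_conj; apply: lD; apply: right_seriesD => //.
by apply: right_series_star; apply: right_series_decr.
Qed.

Lemma right_series_lambda k c x : D k x -> D k (sblambda c x).
Proof. exact: (right_series_lambda_conjg k).1. Qed.

(** Write a' = a ∘ y with y in B^(k+1). Then lambda_a'(x) = lambda_a([sbstar y x] + x), and
    normality of B^(k+2) in (B,+) absorbs [sbstar y x]. *)
Lemma sblambda_congr k a a' x :
  D k (- a + a') -> D k.+1 (- sblambda a x + sblambda a' x).
Proof.
move=> Da; have -> : a' = a * sblambda a^-1 (- a + a').
  by rewrite -sb_addE sb_add_cancel.
rewrite sblambdaM -[sblambda (sblambda _ _) _]sbstarK -sblambdaN.
set z := sbstar _ _; have Dz : D k.+1 z.
  by apply: right_series_star; apply: right_series_lambda.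
rewrite -sblambdaD sbaddA; apply: right_series_lambda.
by rewrite -[X in _ + X]sb_oppK; apply: right_series_conj.
Qed.

End RightSeries.

Lemma right_series_hom (B K : skewBraceType) (f : B -> K) k x :
  skew_brace_hom f -> right_series B k.+1 x -> right_series K k.+1 (f x).
Proof.
move=> hf; elim: k x => [//|k IH]; apply: right_seriesS_ind.
- by rewrite sb_hom0 //; apply: right_series0.
- by move=> u v; rewrite sb_homD // sb_homN //; apply: right_series_sub.
by move=> a b /IH; rewrite sb_hom_star //; apply: right_series_star.
Qed.

Lemma right_nilpotentP n (B : skewBraceType) :
  right_nilpotent n B <-> (forall x, right_series B n.+1 x -> x = 0).
Proof.
rewrite /right_nilpotent; split=> [-> //|H]; apply/seteqP; split=> x; first exact: H.
by move=> ->; apply: right_series0.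
Qed.

Lemma right_nilpotent_le k n (B : skewBraceType) :
  (k <= n)%N -> right_nilpotent k B -> right_nilpotent n B.
Proof.
by move=> le /right_nilpotentP H; apply/right_nilpotentP => x /(right_series_le le)/H.
Qed.

Lemma right_nilpotent_hom0 k (B K : skewBraceType) (f : B -> K) x :
    right_nilpotent k K -> skew_brace_hom f -> right_series B k.+1 x ->
  f x = 0.
Proof. by move=> /right_nilpotentP HK hf Dx; apply/HK/right_series_hom. Qed.

(** * Constructions of skew braces *)

(** Closure under lambda stands in for closure under the circle operation, which follows from a ∘ b
    = a + lambda_a(b). *)
Record subbrace (B : skewBraceType) := Subbrace {
  subbrace_set :> set B;
  subbrace0 : subbrace_set 0;
  subbraceB : forall x y, subbrace_set x -> subbrace_set y -> subbrace_set (x - y);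
  subbrace_lambda : forall x y,
    subbrace_set x -> subbrace_set y -> subbrace_set (sblambda x y);
  subbraceV : forall x, subbrace_set x -> subbrace_set x^-1
}.

Definition subbrace_sort (B : skewBraceType) (S : subbrace B) : Type := S.

HB.instance Definition _ (B : skewBraceType) (S : subbrace B) :=
  SubChoice.on (subbrace_sort S).

Section Subbrace.
Variables (B : skewBraceType) (C : subbrace B).
Local Notation S := (subbrace_set C).
Local Notation T := (subbrace_sort C).

Lemma subbraceN x : S x -> S (- x).
Proof. by rewrite -[- x]sbadd0r; apply/subbraceB/subbrace0. Qed.

Lemma subbraceD x y : S x -> S y -> S (x + y).
Proof. by move=> Sx /subbraceN Sy; rewrite -[y]sb_oppK; apply: subbraceB. Qed.

Lemma subbraceM x y : S x -> S y -> S (x * y).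
Proof. by move=> Sx Sy; rewrite sb_mulE; apply/subbraceD/subbrace_lambda. Qed.

Lemma subbrace1 : S 1.
Proof. by rewrite sb_one; apply: subbrace0. Qed.

Definition subbrace_mk x (Sx : S x) : T := exist (fun x => x \in S) x (mem_set Sx).

Lemma subbrace_valP (x : T) : S (val x). Proof. exact: set_valP. Qed.

Definition subbrace_zero : T := subbrace_mk (subbrace0 C).
Definition subbrace_one : T := subbrace_mk subbrace1.
Definition subbrace_opp (x : T) : T := subbrace_mk (subbraceN (subbrace_valP x)).
Definition subbrace_inv (x : T) : T := subbrace_mk (subbraceV (subbrace_valP x)).
Definition subbrace_add (x y : T) : T :=
  subbrace_mk (subbraceD (subbrace_valP x) (subbrace_valP y)).
Definition subbrace_mul (x y : T) : T :=
  subbrace_mk (subbraceM (subbrace_valP x) (subbrace_valP y)).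

Fact subbrace_mulA : associative subbrace_mul.
Proof. by move=> x y z; apply/val_inj/mulgA. Qed.

Fact subbrace_mul1g : left_id subbrace_one subbrace_mul.
Proof. by move=> x; apply/val_inj/mul1g. Qed.

Fact subbrace_mulg1 : right_id subbrace_one subbrace_mul.
Proof. by move=> x; apply/val_inj/mulg1. Qed.

Fact subbrace_mulVg : left_inverse subbrace_one subbrace_inv subbrace_mul.
Proof. by move=> x; apply/val_inj/mulVg. Qed.

Fact subbrace_mulgV : right_inverse subbrace_one subbrace_inv subbrace_mul.
Proof. by move=> x; apply/val_inj/mulgV. Qed.

HB.instance Definition _ := isGroup.Build T
  subbrace_mulA subbrace_mul1g subbrace_mulg1 subbrace_mulVg subbrace_mulgV.

Fact subbrace_addA x y z :
  subbrace_add x (subbrace_add y z) = subbrace_add (subbrace_add x y) z.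
Proof. exact/val_inj/sbaddA. Qed.

Fact subbrace_add0r x : subbrace_add subbrace_zero x = x.
Proof. exact/val_inj/sbadd0r. Qed.

Fact subbrace_addr0 x : subbrace_add x subbrace_zero = x.
Proof. exact/val_inj/sbaddr0. Qed.

Fact subbrace_addNr x : subbrace_add (subbrace_opp x) x = subbrace_zero.
Proof. exact/val_inj/sbaddNr. Qed.

Fact subbrace_addrN x : subbrace_add x (subbrace_opp x) = subbrace_zero.
Proof. exact/val_inj/sbaddrN. Qed.

Fact subbrace_mulDr (x y z : T) :
  x * subbrace_add y z = subbrace_add (subbrace_add (x * y) (subbrace_opp x)) (x * z).
Proof. exact/val_inj/sb_mulDr. Qed.

HB.instance Definition _ := Group_isSkewBrace.Build T
  subbrace_addA subbrace_add0r subbrace_addr0 subbrace_addNr subbrace_addrN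
  subbrace_mulDr.

Lemma subbrace_val_hom : @skew_brace_hom T B val.
Proof. by []. Qed.

Lemma subbrace_right_nilpotent n : right_nilpotent n B -> right_nilpotent n T.
Proof.
move=> nilB; apply/right_nilpotentP => x Dx; apply/val_inj.
exact: right_nilpotent_hom0 nilB subbrace_val_hom Dx.
Qed.

End Subbrace.

Section Product.
Variables K L : skewBraceType.
Local Notation T := (K * L)%type.

Definition pair_add (x y : T) : T := (x.1 + y.1, x.2 + y.2).
Definition pair_opp (x : T) : T := (- x.1, - x.2).
Definition pair_zero : T := (0, 0).

Fact pair_addA x y z : pair_add x (pair_add y z) = pair_add (pair_add x y) z.
Proof. by rewrite /pair_add !sbaddA. Qed.

Fact pair_add0r x : pair_add pair_zero x = x.
Proof. by case: x => a b; rewrite /pair_add !sbadd0r. Qed.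

Fact pair_addr0 x : pair_add x pair_zero = x.
Proof. by case: x => a b; rewrite /pair_add !sbaddr0. Qed.

Fact pair_addNr x : pair_add (pair_opp x) x = pair_zero.
Proof. by rewrite /pair_add !sbaddNr. Qed.

Fact pair_addrN x : pair_add x (pair_opp x) = pair_zero.
Proof. by rewrite /pair_add !sbaddrN. Qed.

Fact pair_mulDr (x y z : T) :
  x * pair_add y z = pair_add (pair_add (x * y) (pair_opp x)) (x * z).
Proof. by congr pair; apply: sb_mulDr. Qed.

HB.instance Definition _ := Group_isSkewBrace.Build T
  pair_addA pair_add0r pair_addr0 pair_addNr pair_addrN pair_mulDr.

Lemma fst_skew_brace_hom : @skew_brace_hom T K fst. Proof. by []. Qed.

Lemma snd_skew_brace_hom : @skew_brace_hom T L snd. Proof. by []. Qed.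

Lemma pair_right_nilpotent n :
  right_nilpotent n K -> right_nilpotent n L -> right_nilpotent n (T : skewBraceType).
Proof.
move=> nilK nilL; apply/right_nilpotentP => x Dx.
rewrite [x]surjective_pairing (right_nilpotent_hom0 nilK fst_skew_brace_hom Dx).
by rewrite (right_nilpotent_hom0 nilL snd_skew_brace_hom Dx).
Qed.

End Product.

(* Additively the direct product of [G^A] and [A]; the operator [lambda_(f, a)] is
   [lambda_a] on [A] and turns [h] into [fun c => h (c * a)] on [G^A]. *)
Definition wreath (G : groupType) (A : skewBraceType) : Type :=
  ((A -> G) * A)%type.

HB.instance Definition _ (G : groupType) (A : skewBraceType) :=
  Choice.on (wreath G A).

Section Wreath.
Variables (G : groupType) (A : skewBraceType).
Local Notation T := (wreath G A).
Implicit Types x y z : T.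

Definition wreath_mul x y : T := (fun c => x.1 c * y.1 (c * x.2), x.2 * y.2).
Definition wreath_one : T := (fun=> 1, 1).
Definition wreath_inv x : T := (fun c => (x.1 (c * x.2^-1))^-1, x.2^-1).
Definition wreath_add x y : T := (fun c => x.1 c * y.1 c, x.2 + y.2).
Definition wreath_zero : T := (fun=> 1, 0).
Definition wreath_opp x : T := (fun c => (x.1 c)^-1, - x.2).

Fact wreath_mulA : associative wreath_mul.
Proof. by move=> x y z; congr pair; [apply/funext => c|]; rewrite /= !mulgA. Qed.

Fact wreath_mul1g : left_id wreath_one wreath_mul.
Proof.
by case=> f a; congr pair; [apply/funext => c|]; rewrite /= ?mulg1 mul1g.
Qed.

Fact wreath_mulg1 : right_id wreath_one wreath_mul.
Proof. by case=> f a; congr pair; [apply/funext => c|]; rewrite /= mulg1. Qed.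

Fact wreath_mulVg : left_inverse wreath_one wreath_inv wreath_mul.
Proof. by move=> x; congr pair; [apply/funext => c|]; rewrite /= mulVg. Qed.

Fact wreath_mulgV : right_inverse wreath_one wreath_inv wreath_mul.
Proof.
by move=> x; congr pair; [apply/funext => c|]; rewrite /= ?mulgK mulgV.
Qed.

HB.instance Definition _ := isGroup.Build T
  wreath_mulA wreath_mul1g wreath_mulg1 wreath_mulVg wreath_mulgV.

Fact wreath_addA x y z :
  wreath_add x (wreath_add y z) = wreath_add (wreath_add x y) z.
Proof.
by congr pair; [apply/funext => c|]; rewrite /= ?mulgA ?sbaddA.
Qed.

Fact wreath_add0r x : wreath_add wreath_zero x = x.
Proof.
by case: x => f a; congr pair; [apply/funext => c|]; rewrite /= ?mul1g ?sbadd0r.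
Qed.

Fact wreath_addr0 x : wreath_add x wreath_zero = x.
Proof.
by case: x => f a; congr pair; [apply/funext => c|]; rewrite /= ?mulg1 ?sbaddr0.
Qed.

Fact wreath_addNr x : wreath_add (wreath_opp x) x = wreath_zero.
Proof.
by congr pair; [apply/funext => c|]; rewrite /= ?mulVg ?sbaddNr.
Qed.

Fact wreath_addrN x : wreath_add x (wreath_opp x) = wreath_zero.
Proof.
by congr pair; [apply/funext => c|]; rewrite /= ?mulgV ?sbaddrN.
Qed.

Fact wreath_mulDr x y z :
  x * wreath_add y z = wreath_add (wreath_add (x * y) (wreath_opp x)) (x * z).
Proof.
congr pair; last exact: sb_mulDr.
by apply/funext => c; rewrite /= !mulgA mulgVK.
Qed.

HB.instance Definition _ := Group_isSkewBrace.Build T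
  wreath_addA wreath_add0r wreath_addr0 wreath_addNr wreath_addrN wreath_mulDr.

Lemma wreath_snd_hom : @skew_brace_hom T A snd. Proof. by []. Qed.

Lemma wreath_lambda1 x y c : (sblambda x y).1 c = y.1 (c * x.2).
Proof. by rewrite /sblambda /= mulKg. Qed.

(** Elements of the (n+1)-st term have zero component in A, so their lambda is the identity and the
    next term vanishes. *)
Lemma wreath_right_nilpotent n : right_nilpotent n A -> right_nilpotent n.+1 T.
Proof.
move=> nilA; apply/right_nilpotentP; apply: right_seriesS_ind => //.
  by move=> x y -> ->; rewrite sbaddrN.
move=> x y Dx; have x2 := right_nilpotent_hom0 nilA wreath_snd_hom Dx.
have -> : sbstar x y = y - y; last by rewrite sbaddrN.
congr sbadd; rewrite [LHS]surjective_pairing [RHS]surjective_pairing.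
congr pair; first by apply/funext => c; rewrite wreath_lambda1 x2 -sb_one mulg1.
by rewrite (sb_hom_lambda wreath_snd_hom) x2 -sb_one sblambda1.
Qed.

End Wreath.

(** * Finiteness and permutations *)

(** Only an injection is asked for, so products, function types and quotients are handled by giving
    an encoding. *)
Definition finite_sort (K : Type) : Prop :=
  exists (T : finType) (f : K -> T), injective f.

Lemma finite_sort_pair (K L : Type) :
  finite_sort K -> finite_sort L -> finite_sort (K * L).
Proof.
move=> [T [f f_inj]] [U [g g_inj]]; exists (T * U)%type, (fun x => (f x.1, g x.2)).
by move=> [a b] [c d] [/f_inj /= -> /g_inj /= ->].
Qed.

Lemma finite_sort_fun (K L : Type) :
  finite_sort K -> finite_sort L -> finite_sort (K -> L).
Proof.
move=> [T [f f_inj]] [U [g g_inj]].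
(* [None] marks the points of [T] outside the image of [f]. *)
pose enc (h : K -> L) : {ffun T -> option U} :=
  [ffun t => if pselect (exists x, f x = t) is left E
             then Some (g (h (sval (cid E)))) else None].
exists {ffun T -> option U}, enc => h h' /ffunP E; apply/funext => x.
move: (E (f x)); rewrite !ffunE; case: pselect => [e|[]]; last by exists x.
by case: cid => y /= /f_inj -> [/g_inj].
Qed.

Lemma finite_sort_setT (K : Type) : finite_sort K -> finite_set [set: K].
Proof.
move=> [T [f f_inj]]; rewrite -(preimage_setT f); apply: finite_preimage.
  by move=> x y _ _ /f_inj.
exact: finite_finset.
Qed.

Lemma setT_finite_sort (X : Type) : finite_set [set: X] -> finite_sort X.
Proof.
move=> [m /card_eqPle[/pcard_leP[f] _]].
have fP x : (f x < m)%N by have := @funS _ _ _ _ f x I.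
exists 'I_m, (fun x => Ordinal (fP x)) => x y [/inj H]; apply: H; exact: mem_set.
Qed.

(** A partial injection of a finite set extends to a permutation; its pairs are added one at a time,
    each corrected by a transposition. *)
Lemma perm_extension (T : finType) (r : rel T) :
    (forall x y x' y', r x y -> r x' y' -> (x = x' <-> y = y')) ->
  exists s : {perm T}, forall x y, r x y -> s x = y.
Proof.
move=> r_inj.
suff [s sP] : exists s : {perm T},
    {in [seq p <- enum {: T * T} | r p.1 p.2], forall p, s p.1 = p.2}.
  by exists s => x y rxy; apply: (sP (x, y)); rewrite mem_filter rxy mem_enum.
have: all (fun p => r p.1 p.2) [seq p <- enum {: T * T} | r p.1 p.2].
  exact: filter_all.
elim: [seq _ <- _ | _] => [|[x y] l IH] /=; first by exists 1.
(* Products of permutations act left to right: the transposition sends [s x] to [y] and fixes the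
   images already prescribed. *)
move=> /andP[rxy /[dup] rl /IH[s sP]]; exists (s * tperm (s x) y).
move=> p; rewrite inE permM => /predU1P[->|pl]; first by rewrite tpermL.
have rp := allP rl p pl; rewrite (sP p pl).
have [E|ne] := eqVneq p.1 x.
  by rewrite -E sP // ((r_inj _ _ _ _ rp rxy).1 E) tperm1 perm1.
rewrite tpermD //.
  by rewrite -(sP p pl) (inj_eq perm_inj) eq_sym.
by apply: contra ne => /eqP/esym/(r_inj _ _ _ _ rp rxy).2 ->.
Qed.

(** * Words in the free object *)

Section FreeObject.
Variables (n : nat) (X : Type) (B : skewBraceType) (i : X -> B).
Hypothesis hB : is_free_RN n i.

Lemma free_nilpotent : right_nilpotent n B.
Proof. by case: hB. Qed.

Lemma free_extend (K : skewBraceType) (f : X -> K) :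
    right_nilpotent n K ->
  exists phi : B -> K, skew_brace_hom phi /\ forall x, phi (i x) = f x.
Proof.
by case: hB => _ H /H /(_ f)[phi [[hphi ->] _]]; exists phi.
Qed.

Lemma free_ext (K : skewBraceType) (phi psi : B -> K) :
    right_nilpotent n K -> skew_brace_hom phi -> skew_brace_hom psi ->
  (forall x, phi (i x) = psi (i x)) -> phi = psi.
Proof.
case: hB => _ H nilK hphi hpsi E; have [chi [_ uniq]] := H K nilK (phi \o i).
by rewrite -(uniq phi) ?(uniq psi) //; split=> //; apply/funext => x /=; rewrite E.
Qed.

(* [(s, a, x)] stands for [lambda_a(x)] or, when [s] is false, its opposite. *)
Definition letter : Type := (bool * B * X)%type.

Definition letter_val (l : letter) : B :=
  let v := sblambda l.1.2 (i l.2) in if l.1.1 then v else - v.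

Definition word_val (w : seq letter) : B :=
  foldr (fun l b => letter_val l + b) 0 w.

Lemma word_val_cat u v : word_val (u ++ v) = word_val u + word_val v.
Proof. by elim: u => [|l u IH] /=; rewrite ?sbadd0r // IH sbaddA. Qed.

Lemma word_valN u : exists v, word_val v = - word_val u.
Proof.
elim: u => [|[[s a] x] u [v IH]] /=; first by exists [::]; rewrite sb_opp0.
exists (v ++ [:: (~~ s, a, x)]); rewrite word_val_cat IH sb_oppD /= sbaddr0.
by congr sbadd; case: s; rewrite /letter_val //= sb_oppK.
Qed.

Lemma word_val_lambda c u : exists v, word_val v = sblambda c (word_val u).
Proof.
elim: u => [|[[s a] x] u [v IH]] /=; first by exists [::]; rewrite sblambda0.
exists ((s, c * a, x) :: v); rewrite /= IH sblambdaD; congr sbadd.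
by rewrite /letter_val /= sblambdaM; case: s; rewrite ?sblambdaN.
Qed.

(** The word values form a sub skew brace containing i(X). Freeness maps B into it, and by
    uniqueness this map followed by the inclusion is the identity. *)
Lemma word_val_surj b : exists w, word_val w = b.
Proof.
pose S := [set b | exists w, word_val w = b].
have S0 : S 0 by exists [::].
have SN x : S x -> S (- x) by move=> [u <-]; apply: word_valN.
have SB x y : S x -> S y -> S (x - y).
  by move=> [u <-] /SN [v <-]; exists (u ++ v); rewrite word_val_cat.
have Sl c y : S y -> S (sblambda c y) by move=> [u <-]; apply: word_val_lambda.
have SV x : S x -> S x^-1 by move=> Sx; rewrite sb_invE; apply/SN/Sl.
pose C := Subbrace S0 SB (fun x y _ => @Sl x y) SV.
have Si x : S (i x).
  by exists [:: (true, 1, x)]; rewrite /= /letter_val /= sblambda1 sbaddr0.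
have nilC := subbrace_right_nilpotent C free_nilpotent.
have [phi [hphi phiE]] := free_extend (fun x => subbrace_mk (C := C) (Si x)) nilC.
have -> : b = val (phi b); last exact: (subbrace_valP (phi b)).
have hval := skew_brace_hom_comp (@subbrace_val_hom B C) hphi.
suff E : id = val \o phi by exact: (congr1 (@^~ b) E).
by apply: (free_ext free_nilpotent) => // x /=; rewrite phiE.
Qed.

(** * Reduced words and finite quotients *)

Definition fin_equiv k (a b : B) : Prop :=
  forall (K : skewBraceType) (f : B -> K),
    finite_sort K -> right_nilpotent k K -> skew_brace_hom f -> f a = f b.

(** The product of targets separating the individual pairs separates all of them at once. *)
Lemma fin_separate k m (a b : nat -> B) :
  exists (K : skewBraceType) (f : B -> K),
    [/\ finite_sort K, right_nilpotent k K, skew_brace_hom f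
      & forall j, (j < m)%N -> ~ fin_equiv k (a j) (b j) -> f (a j) <> f (b j)].
Proof.
elim: m => [|m [K [f [finK nilK hf fP]]]].
  (* With no pair to separate, the zero sub skew brace serves as target. *)
  pose S := [set 0 : B].
  have S0 : S 0 by [].
  have SB x y : S x -> S y -> S (x - y) by move=> -> ->; rewrite /S /= sbaddrN.
  have Sl x y : S x -> S y -> S (sblambda x y).
    by move=> _ ->; rewrite /S /= sblambda0.
  have SV x : S x -> S x^-1 by move=> ->; rewrite /S /= -sb_one invg1.
  pose C := Subbrace S0 SB Sl SV.
  have C1 (x y : subbrace_sort C) : x = y.
    by apply/val_inj; rewrite (subbrace_valP x) (subbrace_valP y).
  exists (subbrace_sort C), (fun=> 0); split=> //.
  - by exists unit, (fun=> tt) => x y _; apply: C1.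
  - by apply/right_nilpotentP => x _; apply: C1.
  - by split=> x y; apply: C1.
have [eq|] := pselect (fin_equiv k (a m) (b m)).
  exists K, f; split=> // j; rewrite ltnS leq_eqVlt => /predU1P[->|]; last exact: fP.
  by [].
move=> /existsNP[L] /existsNP[g].
move=> /not_implyP[finL] /not_implyP[nilL] /not_implyP[hg ne].
exists (K * L)%type, (fun x => (f x, g x)); split.
- exact: finite_sort_pair.
- exact: pair_right_nilpotent.
- case: hf hg => fD fM [gD gM].
  by split=> x y; congr pair; rewrite ?fD ?fM ?gD ?gM.
- move=> j; rewrite ltnS leq_eqVlt => /predU1P[-> _ [_ /ne]|jm nej [E _]] //.
  exact: (fP j jm nej E).
Qed.

(** Reducedness as in a free group on symbols (a, x), with a taken up to [fin_equiv k]. *)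
Definition reduced k (w : seq letter) : Prop :=
  forall u l l' v, w = u ++ l :: l' :: v ->
    l.1.1 <> l'.1.1 -> l.2 = l'.2 -> ~ fin_equiv k l.1.2 l'.1.2.

(* The letters [(f a, x)] act on the points [0 .. size w] so that the [j]-th
   letter of [w] moves [j] to [j.+1]. *)
Lemma reduced_word_perm k (w : seq letter) : reduced k w ->
  exists (A : skewBraceType) (f : B -> A),
    [/\ finite_sort A, right_nilpotent k A, skew_brace_hom f
      & exists g : A -> X -> {perm 'I_(size w).+1},
        forall u s a x v, w = u ++ (s, a, x) :: v ->
          (if s then g (f a) x else (g (f a) x)^-1) (inord (size u)) =
          inord (size u).+1].
Proof.
(* A non-empty word supplies the default letter [l0] for [nth]. *)
case: w => [|l0 w0].
  move=> _; have [A [f [finA nilA hf _]]] := fin_separate k 0 (fun=> 0) (fun=> 0).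
  by exists A, f; split=> //; exists (fun _ _ => 1) => -[].
move: (l0 :: w0) => {w0} w redw; set m := size w.
(* The pairs are the parameters of consecutive letters; the last one involves the default letter and
   is excluded in [adj]. *)
have [A [f [finA nilA hf fP]]] :=
  fin_separate k m (fun j => (nth l0 w j).1.2) (fun j => (nth l0 w j.+1).1.2).
exists A, f; split=> //.
have adj j : (j.+1 < m)%N -> (nth l0 w j).1.1 <> (nth l0 w j.+1).1.1 ->
    (nth l0 w j).2 = (nth l0 w j.+1).2 ->
    f (nth l0 w j).1.2 <> f (nth l0 w j.+1).1.2.
  move=> jm ne eq; apply: fP; first exact: ltnW.
  apply: (redw (take j w) _ _ (drop j.+2 w)) => //.
  by rewrite -!drop_nth ?cat_take_drop // ltnW.
(* A positive letter at position j gives an edge from j to j+1, a negative one the reversed edge;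
   edges are labelled by (f(a), x). *)
pose edge c x (p q : 'I_m.+1) := exists j,
  [/\ (j < m)%N, f (nth l0 w j).1.2 = c, (nth l0 w j).2 = x
    & if (nth l0 w j).1.1 then (p = j :> nat) /\ (q = j.+1 :> nat)
      else (p = j.+1 :> nat) /\ (q = j :> nat)].
have ext c x : exists s : {perm 'I_m.+1}, forall p q, edge c x p q -> s p = q.
  have [|s sP] := @perm_extension _ (fun p q => `[< edge c x p q >]).
    move=> p q p' q' /asboolP[j [jm Ec Ex H]] /asboolP[j' [jm' Ec' Ex' H']].
    (* Distinct edges with one label can share a source or a target only if they come from adjacent
       letters of opposite signs, which [adj] rules out. *)
    have adj1 : j' = j.+1 -> (nth l0 w j).1.1 = (nth l0 w j').1.1.
      move=> E; subst j'; apply: contrapT => ne.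
      by apply: (adj j) => //; rewrite ?Ec ?Ec' ?Ex ?Ex'.
    have adj2 : j = j'.+1 -> (nth l0 w j).1.1 = (nth l0 w j').1.1.
      move=> E; subst j; apply: contrapT => ne.
      by apply: (adj j') => //; rewrite ?Ec ?Ec' ?Ex ?Ex' // => /esym.
    suff: (p = p' :> nat) <-> (q = q' :> nat).
      by move=> [h1 h2]; split=> E; apply/val_inj; [apply/h1|apply/h2]; rewrite E.
    move: H H' adj1 adj2.
    case: (nth l0 w j).1.1; case: (nth l0 w j').1.1 => -[-> ->] [-> ->].
    - by lia.
    - by move=> h1 h2; split=> E; [have := h2 E|have := h1 (esym E)].
    - by move=> h1 h2; split=> E; [have := h1 (esym E)|have := h2 E].
    - by lia.
  by exists s => p q e; apply/sP/asboolP.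
exists (fun c x => sval (cid (ext c x))) => u s a x v Ew.
have um : (size u < m)%N by rewrite /m Ew size_cat addnS ltnS leq_addr.
have nu : nth l0 w (size u) = (s, a, x) by rewrite Ew nth_cat ltnn subnn.
case: cid => g gP /=; case: s Ew nu => Ew nu.
  apply: gP; exists (size u); rewrite nu; split=> //=.
  by rewrite !inordK // ltnS // ltnW.
rewrite -(gP (inord (size u).+1) (inord (size u))) ?permK //.
exists (size u); rewrite nu; split=> //=.
by rewrite !inordK // ltnS // ltnW.
Qed.

(** In the finite skew brace [wreath P A], of class at most k+1, the word acts as a permutation
    taking 0 to its length. Its value vanishes there, so the length is 0. *)
Lemma reduced_word_nil k (w : seq letter) :
  (k < n)%N -> reduced k w -> fin_equiv k.+1 (word_val w) 0 -> w = [::].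
Proof.
move=> kn /reduced_word_perm[A [f [finA nilA hf [g gP]]]] w0.
set P := (perm_of _) in g gP.
have nilW : right_nilpotent k.+1 (wreath P A) by exact: wreath_right_nilpotent.
have [psi [hpsi psiE]] := free_extend
  (fun x => ((g^~ x), f (i x)) : wreath P A) (right_nilpotent_le kn nilW).
(* Both maps agree on generators; hence [psi a] has A-component f(a), which governs its lambda. *)
have psi2 : snd \o psi = f.
  apply: free_ext => //.
  - exact: right_nilpotent_le (ltnW kn) nilA.
  - exact: skew_brace_hom_comp (@wreath_snd_hom P A) hpsi.
  - by move=> x; rewrite /= psiE.
(* Evaluation at the unit is a homomorphism from (B,+) to [P]; lambda_a moves the evaluation point
   from 1 to f(a). *)
pose h b : P := (psi b).1 1.
have h0 : h 0 = 1 by rewrite /h (sb_hom0 hpsi).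
have hD b c : h (b + c) = h b * h c by rewrite /h (sb_homD hpsi).
have hl a x : h (sblambda a (i x)) = g (f a) x.
  by rewrite /h (sb_hom_lambda hpsi) wreath_lambda1 mul1g psiE /= -psi2.
have hN b : h (- b) = (h b)^-1 by rewrite /h (sb_homN hpsi).
(* The suffix [v] starts where the prefix [u] has led, at the point [size u]. *)
have walk v u : w = u ++ v ->
    h (word_val v) (inord (size u)) = inord (size u + size v).
  elim: v u => [|[[s a] x] v IH] u Ew; first by rewrite addn0 /= h0 perm1.
  rewrite /= hD permM addnS -addSn.
  have -> : h (letter_val (s, a, x)) = if s then g (f a) x else (g (f a) x)^-1.
    by rewrite /letter_val /=; case: s {Ew}; rewrite ?hN hl.
  by rewrite (gP _ _ _ _ _ Ew) -(size_rcons u (s, a, x)) IH // cat_rcons.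
have finW : finite_sort (wreath P A).
  apply: finite_sort_pair => //; apply: finite_sort_fun => //.
  by exists P, id.
have := walk w [::] erefl.
rewrite add0n /h (w0 _ psi finW nilW hpsi) -/(h 0) h0 perm1.
by move=> /(congr1 val); rewrite /= !inordK // => /esym/size0nil.
Qed.

Lemma fin_equiv_right_series k b :
  (k <= n)%N -> fin_equiv k b 0 -> right_series B k.+1 b.
Proof.
elim: k b => [//|k IH] b kn; have [w <-] := word_val_surj b.
(* Inner induction on the length of the word, at a fixed level k+1. *)
have [m] := ubnP (size w); elim: m w => // m IHm w /ltnSE wm w0.
have [red|] := pselect (reduced k w).
  by rewrite (reduced_word_nil kn red w0); apply: right_series0.
move=> /existsNP[u] /existsNP[l] /existsNP[l'] /existsNP[v].
move=> /not_implyP[Ew] /not_implyP[ns] /not_implyP[ex /contrapT e].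
set D := right_series B k.+2.
(* By the outer induction the two parameters agree modulo B^(k+1), so the letters cancel modulo
   B^(k+2). *)
have Dll : D (letter_val l + letter_val l').
  have Daa a a' : fin_equiv k a a' -> right_series B k.+1 (- a + a').
    move=> eqa; apply: IH; first exact: ltnW.
    move=> K f finK nilK hf.
    by rewrite (sb_homD hf) (sb_homN hf) (eqa _ _ finK nilK hf) sbaddNr (sb_hom0 hf).
  case: l l' ns ex e {Ew} => [[s a] x] [[s' a'] x'] /= ns <- e.
  case: s s' ns => -[] // _; rewrite /letter_val /=; last first.
    by apply: sblambda_congr; apply: Daa.
  set y := sblambda a _; set z := sblambda a' _.
  have -> : y - z = - (y + (- y + z) - y) by rewrite sb_add_cancel sb_oppD sb_oppK.
  apply: right_seriesN; apply: right_series_conj.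
  by apply: sblambda_congr; apply: Daa.
(* Deleting the pair changes the value by a conjugate in B^(k+2). Targets of class at most k+1 kill
   it, so the shorter word is still equivalent to 0. *)
have Ewval : word_val w = word_val u + (letter_val l + letter_val l') - word_val u
    + word_val (u ++ v).
  by rewrite Ew !word_val_cat /= !sbaddA -[_ - _ + _]sbaddA sbaddNr sbaddr0.
have Dc := right_series_conj (word_val u) Dll.
rewrite Ewval; apply: right_seriesD => //; apply: IHm.
  by apply: leq_trans wm; rewrite Ew !size_cat /=; lia.
move=> K f finK nilK hf; rewrite -[RHS](w0 _ f finK nilK hf) Ewval (sb_homD hf).
by rewrite (right_nilpotent_hom0 nilK hf Dc) sbadd0r.
Qed.

End FreeObject.

(** * Residual finiteness and the Hopf property *)

Section Kernel.
Variables (B K : skewBraceType) (f : B -> K).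
Hypothesis hf : skew_brace_hom f.

Fact kernel_is_ideal : is_ideal [set x | f x = 0].
Proof.
have f1 : f 1 = 1 by rewrite !sb_one (sb_hom0 hf).
have fV x : f x^-1 = (f x)^-1.
  by apply: (mulgI (f x)); rewrite -(sb_homM hf) !mulgV.
split.
- split; first split.
  + exact: sb_hom0 hf.
  + move=> x y; rewrite /= => fx fy; rewrite -[RHS](sbaddrN (0 : K)) -{1}fx -fy.
    by rewrite -(sb_homN hf) -(sb_homD hf).
  + move=> x y /= fx; rewrite -[RHS](sbaddNr (f y)).
    transitivity (f (- y + (x + y))); first by [].
    by rewrite !(sb_homD hf) (sb_homN hf) fx sbadd0r.
- split; first split.
  + by rewrite /= f1 sb_one.
  + by move=> x y /= fx fy; rewrite (sb_homM hf) fV fx fy -sb_one mulgV.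
  + by move=> x y /= fx; rewrite conjgE !(sb_homM hf) fV fx -sb_one mul1g mulVg.
move=> b; apply/seteqP; split=> [_ [x /= fx <-]|x /= fx].
  by rewrite /= (sb_hom_lambda hf) fx sblambda0.
exists (sblambda b^-1 x); last by rewrite -sblambdaM mulgV sblambda1.
by rewrite /= (sb_hom_lambda hf) fx sblambda0.
Qed.

Definition kernel : ideal B := Ideal kernel_is_ideal.

(** A coset is encoded by the image of a chosen representative; representatives with equal images
    differ by an element of the kernel. *)
Lemma finite_quot_kernel : finite_sort K -> finite_sort (quot kernel).
Proof.
move=> [T [g g_inj]]; exists T, (fun C => g (f (sval (cid (quot_piP C))))).
move=> C D /g_inj; case: cid => a Ca; case: cid => b Db /= E; rewrite Ca Db.
apply/val_inj/seteqP; split=> _ [x /= fx <-].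
  exists (- b + (a + x)); last by rewrite sb_add_cancel.
  by rewrite /= !(sb_homD hf) (sb_homN hf) fx sbaddr0 E sbaddNr.
exists (- a + (b + x)); last by rewrite sb_add_cancel.
by rewrite /= !(sb_homD hf) (sb_homN hf) fx sbaddr0 E sbaddNr.
Qed.

End Kernel.

Lemma residually_finiteP (B : skewBraceType) :
    (forall b : B, b <> 0 -> exists (K : skewBraceType) (f : B -> K),
       [/\ finite_sort K, skew_brace_hom f & f b <> 0]) ->
  residually_finite B.
Proof.
move=> H; apply/seteqP; split=> b; last by move=> -> I _; apply: ideal_0.
move=> Hb; apply: contrapT => /H[K [f [finK hf]]]; apply.
exact: (Hb (kernel hf) (finite_sort_setT (finite_quot_kernel hf finK))).
Qed.

(** An element that no such f separates from 0 lies in B^(n+1), which is zero. *)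
Lemma free_separated (n : nat) (X : Type) (B : skewBraceType) (i : X -> B) :
    is_free_RN n i -> forall b : B, b <> 0 ->
  exists (K : skewBraceType) (f : B -> K),
    [/\ finite_sort K, right_nilpotent n K, skew_brace_hom f & f b <> 0].
Proof.
move=> hB b b0; apply: contrapT => H; apply: b0.
move: (free_nilpotent hB) => /right_nilpotentP; apply.
apply: (fin_equiv_right_series hB) => // K f finK nilK hf.
by rewrite (sb_hom0 hf); apply: contrapT => fb; apply: H; exists K, f.
Qed.

Lemma free_hopfian (n : nat) (X : Type) (B : skewBraceType) (i : X -> B) :
  is_free_RN n i -> finite_sort X -> hopfian B.
Proof.
move=> hB finX I I0 [phi [hphi [psi phiK psiK]]]; apply: I0.
apply/seteqP; split=> b; last by move=> ->; apply: ideal_0.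
move=> Ib; apply: contrapT => /(free_separated hB)[K [f [finK nilK hf]]]; apply.
have hpi : skew_brace_hom (quot_pi I : B -> quot I).
  by split=> x y; [apply/esym/quot_piD | apply/esym/quot_piM].
have hpsi : skew_brace_hom psi.
  by split=> x y; apply: (can_inj phiK); rewrite ?(sb_homD hphi) ?(sb_homM hphi) !psiK.
(* Projection followed by the inverse isomorphism: a surjective endomorphism of B that kills I. *)
pose theta b := psi (quot_pi I b).
have hth : skew_brace_hom theta := skew_brace_hom_comp hpsi hpi.
have th_surj c : exists d, theta d = c.
  by have [d E] := quot_piP (phi c); exists d; rewrite /theta -E phiK.
have thb : theta b = 0.
  rewrite -(sb_hom0 hth) /theta; congr psi; apply: val_inj; rewrite /=.
  apply/seteqP; split=> _ [x Ix <-].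
    by exists (b + x); rewrite ?sbadd0r //; apply: ideal_add.
  exists (- b + x); last by rewrite sb_add_cancel sbadd0r.
  by apply: ideal_add => //; apply: ideal_opp.
have iter_hom j : skew_brace_hom (iter j theta).
  by elim: j => [//|j IH]; apply: skew_brace_hom_comp hth IH.
have iter_surj j c : exists d, iter j theta d = c.
  elim: j c => [|j IH] c; first by exists c.
  by have [d <-] := th_surj c; have [e <-] := IH d; exists e.
have [T [enc enc_inj]] := finite_sort_fun finX finK.
(* A homomorphism from B to K is determined by its values on X, so among [#|T|.+1] iterates two give
   the same homomorphism. *)
pose F (j : 'I_#|T|.+1) := enc (fun x => f (iter j theta (i x))).
have /injectivePn[j [k jk Ejk]] : ~~ injectiveb F.
  by apply/negP => /injectiveP/leq_card; rewrite card_ord ltnn.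
wlog ltjk : j k jk Ejk / (j < k)%N => [WL|].
  have [/WL|/WL|/val_inj/eqP] := ltngtP j k; [by apply| |by rewrite (negbTE jk)].
  by rewrite eq_sym; apply.
have E : f \o iter j theta = f \o iter k theta.
  apply: (free_ext hB nilK); do ?exact: skew_brace_hom_comp.
  by move=> x; apply: (congr1 (@^~ x) (enc_inj _ _ Ejk)).
(* With b = theta^j(d) and j < k, f(b) = f(theta^k(d)) = f(theta^(k-j-1)(theta(b))) = 0. *)
have [d Ed] := iter_surj j b.
have := congr1 (@^~ d) E; rewrite /= Ed => ->.
by rewrite -(subnK ltjk) iterD iterS Ed thb (sb_hom0 (iter_hom _)) (sb_hom0 hf).
Qed.

Theorem theorem5p4 (n : nat) (hn : (2 <= n)%N) (X : Type) (hX : inhabited X)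
    (B : skewBraceType) (i : X -> B) (hB : is_free_RN n i) :
  residually_finite B /\ (finite_set [set: X]%classic -> hopfian B).
Proof.
split; last by move=> /setT_finite_sort; apply: free_hopfian hB.
apply: residually_finiteP => b /(free_separated hB)[K [f [finK _ hf fb]]].
by exists K, f.
Qed.
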